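(* Let $G$ be an infinite, locally finite, connected simple graph with a fixed vertex $a$, and let $\psi:G\to\mathbb{C}$ be a function. Then the following are equivalent: (1) $M_\psi$ is bounded on $\hat{\mathcal{L}}$. (2) $M_\psi$ is bounded on $\hat{\mathcal{L}}_0$. (3) $\psi$ is bounded on $G$ (i.e. $\|\psi\|_\infty=\sup_{v\in G}|\psi(v)|<\infty$) and $\sigma_\psi:=\sup_{v\sim w} d(a,v)\,|\psi(v)-\psi(w)|$ is finite.
   Context: A graph is always connected, undirected, simple, with infinitely many vertices, each of finite degree; $G$ also denotes its vertex set, $v\sim w$ means $v$ and $w$ are adjacent, $N_v=\{w\in G: w\sim v\}$, and $d$ is the graph distance. $\sup_{v\sim w}$ is the supremum over all (ordered) pairs of adjacent vertices. The Lipschitz space is $\hat{\mathcal{L}}=\{f:G\to\mathbb{C} : \sup_{v\sim w}|f(v)-f(w)|<\infty\}$ with norm $\|f\|_{\hat{\mathcal{L}}}^{a}:=|f(a)|+\sup_{v\sim w}|f(v)-f(w)|$. The little Lipschitz space $\hat{\mathcal{L}}_0$, with the same norm, is the set of $f\in\hat{\mathcal{L}}$ with $\lim_{d(a,v)\to\infty}\max_{w\in N_v}|f(v)-f(w)|=0$. Here $\lim_{d(a,v)\to\infty}F(v)=0$ means: for every $\epsilon>0$ there is $N\in\mathbb{N}$ such that $|F(v)|<\epsilon$ whenever $d(a,v)>N$. For $X=\hat{\mathcal{L}}$ or $\hat{\mathcal{L}}_0$, $M_\psi f:=\psi f$; ''$M_\psi$ is bounded on $X$'' means $\psi f\in X$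 for every $f\in X$ and $M_\psi:X\to X$ is a bounded linear operator. *)

(* Defs.v *)
From HB Require Import structures.
From mathcomp Require Import all_boot all_order all_algebra.
From mathcomp Require Import all_classical all_reals all_analysis.
From mathcomp Require Import finmap complex.

Set Implicit Arguments.
Unset Strict Implicit.
Unset Printing Implicit Defensive.

Import Order.TTheory GRing.Theory Num.Theory.
Local Open Scope classical_set_scope.
Local Open Scope ring_scope.

Record graph := Graph {
  vertex :> choiceType;
  adj : rel vertex;
  adj_sym : symmetric adj;
  adj_irrefl : irreflexive adj;
  adj_finite : forall v, finite_set [set w | adj w v];
  adj_connected : forall v w, exists2 p, path adj v p & last v p = w;
  vertex_infinite : infinite_set [set: vertex] }.

Section Distance.
Variable G : graph.
Implicit Types v w : G.

Definition nbh v : set G := [set w | adj w v].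

Definition walk v w (n : nat) : Prop :=
  exists p, [/\ path (@adj G) v p, last v p = w & size p = n].

Fact walk_exists v w : exists n, `[< walk v w n >].
Proof.
by have [p vp pw] := adj_connected v w; exists (size p); apply/asboolP; exists p.
Qed.

Definition dist v w : nat := ex_minn (walk_exists v w).

End Distance.

Section Lipschitz.
Variables (R : realType) (G : graph) (a : G).
Local Notation C := R[i].
Implicit Types (f psi : G -> C) (X : set (G -> C)).

(* The canonical norm of [R[i]] takes values in [R[i]]; [normc] is the same
   modulus with values in [R]. *)
Local Notation normc := ComplexField.Normc.normc.

Definition edges : set (G * G) := [set e | adj e.1 e.2].

Definition lip_semi f : \bar R :=
  ereal_sup [set (normc (f e.1 - f e.2))%:E | e in edges].

(* The norm as an extended real: finite exactly when [f] is in [Lip]. *)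
Definition lip_norm f : \bar R := ((normc (f a))%:E + lip_semi f)%E.

Definition Lip : set (G -> C) := [set f | (lip_semi f < +oo)%E].

Definition vanishes_at_infinity (F : G -> R) : Prop :=
  forall e : R, 0 < e ->
    exists N : nat, forall v, (N < dist a v)%N -> `|F v| < e.

(* The moduli are nonnegative, so starting the maximum at 0 is harmless. *)
Definition max_var f (v : G) : R :=
  \big[Num.max/0]_(w <- fset_set (nbh v)) normc (f v - f w).

Definition Lip0 : set (G -> C) :=
  [set f | Lip f /\ vanishes_at_infinity (max_var f)].

Definition mul_op psi f : G -> C := psi \* f.

Definition bounded_operator_on X (T : (G -> C) -> (G -> C)) : Prop :=
  [/\ forall f, X f -> X (T f),
      forall (c : C) f g, X f -> X g ->
        T (c *: f + g) = c *: T f + T g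
    & exists M : R, forall f, X f -> (lip_norm (T f) <= M%:E * lip_norm f)%E].

Definition sup_norm psi : \bar R := ereal_sup (range (fun v => (normc (psi v))%:E)).

Definition sigma psi : \bar R :=
  ereal_sup [set ((dist a e.1)%:R * normc (psi e.1 - psi e.2))%:E | e in edges].

End Lipschitz.

(* Main.v *)
Require Import Defs.
From mathcomp Require Import all_boot all_order all_algebra.
From mathcomp Require Import all_classical all_reals all_analysis.
From mathcomp Require Import finmap complex zify ring lra.

(** Boundedness of [M_psi] on the little space already forces the two
conditions on [psi], because they are detected by finitely supported test
functions whose norm is at most 2. Testing on the indicator of [v], and
comparing [v] with any of its neighbours, bounds [|psi v|]. Testing on a
function that depends on the distance [d] to the base point [a] only, rises
with slope 1 from 0 at [a] to the value [n] on the sphere [d = n], and then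
falls back to 0, bounds [n |psi v - psi w|] for [d v = n] and [w] adjacent
to [v], through the Leibniz rule
  [psi f (v) - psi f (w) = psi v (f v - f w) + f w (psi v - psi w)]
with [v] and [w] exchanged: its first term is at most [sup |psi|]
([multiplier_test], [multiplier_sup_norm], [multiplier_sigma]).

Conversely, a function of seminorm [L] grows at most linearly,
[|f w| <= |f a| + L d w], so that the second term of the Leibniz rule is
controlled by [|f a| sup |psi|] and [L sigma]; this is boundedness on the big
space ([multiplier_lip_norm]). For the little space it remains to see that
[psi f] has vanishing variation. There the growth is sublinear: for every
[e > 0] there is [K] with [|f w| <= K + e d w] ([Lip0_sublinear]). Hence
[|f w| |psi v - psi w| <= K |psi v - psi w| + e sigma], and
[|psi v - psi w| <= sigma / d v] tends to 0 ([multiplier_Lip0]). *)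

Set Implicit Arguments.
Unset Strict Implicit.
Unset Printing Implicit Defensive.

Import Order.TTheory GRing.Theory Num.Theory.
Local Open Scope classical_set_scope.
Local Open Scope ring_scope.

Local Notation normc := ComplexField.Normc.normc.

(** * The modulus of a complex number *)

Section Modulus.
Variable R : realType.
Implicit Types x y : R[i].

Lemma normc_ge0 x : 0 <= normc x.
Proof. by case: x => x y; exact: sqrtr_ge0. Qed.

Lemma normc_nat n : normc (n%:R : R[i]) = n%:R.
Proof. by rewrite (@normcMn R 1 n) ComplexField.Normc.normc1. Qed.

Lemma normcD_le x y : normc (x + y) <= normc x + normc y.
Proof. exact: le_normcD. Qed.

Lemma normcBC x y : normc (x - y) = normc (y - x).
Proof. by rewrite -opprB normcN. Qed.

Lemma normcB_le x y : normc (x - y) <= normc x + normc y.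
Proof. by rewrite -(normcN y); exact: normcD_le. Qed.

Lemma normc_natB_le1 (m n : nat) : (m <= n.+1)%N -> (n <= m.+1)%N ->
  normc (m%:R - n%:R : R[i]) <= 1.
Proof.
wlog le_nm : m n / (n <= m)%N => [H mn nm|mn nm].
  by have [/H|/ltnW/H] := leqP n m; [|rewrite normcBC]; exact.
by rewrite -natrB// normc_nat (ler_nat R _ 1) leq_subLR addn1.
Qed.

Lemma normc_leibniz (p q x y : R[i]) :
  normc (p * x - q * y) <= normc p * normc (x - y) + normc y * normc (p - q).
Proof.
have -> : p * x - q * y = p * (x - y) + y * (p - q).
  by ring.
by rewrite -!ComplexField.Normc.normcM normcD_le.
Qed.

End Modulus.

(** * Distance to the base point *)

Section Distance.
Variables (G : graph) (a : G).
Implicit Types u v w : G.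

Lemma dist_walk v : walk a v (dist a v).
Proof. by rewrite /dist; case: ex_minnP => n /asboolP. Qed.

Lemma dist_le_walk v n : walk a v n -> (dist a v <= n)%N.
Proof. by move=> avn; rewrite /dist; case: ex_minnP => m _; apply; exact/asboolP. Qed.

Lemma dist_self : dist a a = 0%N.
Proof. by apply/eqP; rewrite -leqn0; apply: dist_le_walk; exists [::]. Qed.

Lemma dist_eq0 v : dist a v = 0%N -> v = a.
Proof.
move=> av0; have := dist_walk v; rewrite av0 => -[p [_ <-]].
by move=> /size0nil ->.
Qed.

Lemma walk_rcons u v w n : walk v u n -> adj u w -> walk v w n.+1.
Proof.
move=> [p [vp pu sp]] uw; exists (rcons p w).
by rewrite rcons_path vp pu uw last_rcons size_rcons sp.
Qed.

Lemma dist_adj u w : adj u w -> (dist a w <= (dist a u).+1)%N.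
Proof. by move=> uw; apply: dist_le_walk; exact: walk_rcons (dist_walk u) uw. Qed.

Lemma dist_pred v : (0 < dist a v)%N ->
  exists2 u, adj u v & dist a v = (dist a u).+1.
Proof.
move=> v0; have [p [ap pv sp]] := dist_walk v.
move: ap pv sp v0; case/lastP: p => [|p w]; first by move=> _ _ <-.
rewrite rcons_path last_rcons size_rcons => /andP[ap puw] wv sp _.
rewrite {}wv in puw *; exists (last a p) => //.
apply/eqP; rewrite eqn_leq dist_adj// -sp ltnS.
by apply: dist_le_walk; exists p.
Qed.

Lemma has_neighbour v : exists w, adj v w.
Proof.
have [w wv] : exists w, w <> v.
  apply: contrapT => /forallNP H; apply: (@vertex_infinite G).
  by apply: sub_finite_set (finite_set1 v) => w _; exact: contrapT (H w).
have [[|u p] /= vp pw] := adj_connected v w; first by rewrite pw in wv.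
by exists u; case/andP: vp.
Qed.

End Distance.

(** * Suprema over edges as bounds over edges *)

Section Suprema.
Variables (R : realType) (G : graph) (a : G).
Implicit Types (f psi : G -> R[i]) (u v w : G) (B : R).

Lemma lip_semiP f B : (lip_semi f <= B%:E)%E <->
  forall u w, adj u w -> normc (f u - f w) <= B.
Proof.
split=> [fB u w uw|fB].
  rewrite -lee_fin; apply: le_trans fB.
  by apply: ereal_sup_ubound; exists (u, w).
by apply: ge_ereal_sup => _ [[u w] uw <-]; rewrite lee_fin; exact: fB.
Qed.

(** The supremum of an empty set is [-oo]; here [a] has a neighbour, so the
supremum is taken over at least one nonnegative value. *)
Lemma lip_semi_ge0 f : (0 <= lip_semi f)%E.
Proof.
have [w aw] := has_neighbour a.
apply: le_ereal_sup_tmp; exists (normc (f a - f w))%:E; first by exists (a, w).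
by rewrite lee_fin normc_ge0.
Qed.

Lemma ge0_lty (x : \bar R) : (0 <= x)%E -> (x < +oo)%E ->
  exists2 B, 0 <= B & x = B%:E.
Proof. by case: x => // r r0 _; exists r. Qed.

Lemma Lip_semi_real f : Lip f -> exists2 L, 0 <= L & lip_semi f = L%:E.
Proof. by move=> fL; exact: ge0_lty (lip_semi_ge0 f) fL. Qed.

Lemma LipP f : Lip f <-> exists B, forall u w, adj u w -> normc (f u - f w) <= B.
Proof.
split=> [/Lip_semi_real[L _ fL]|[B /lip_semiP fB]].
  by exists L; apply/lip_semiP; rewrite fL.
exact: le_lt_trans fB (ltry _).
Qed.

Lemma sup_normP psi : (sup_norm psi < +oo)%E <->
  exists B, forall v, normc (psi v) <= B.
Proof.
split=> [|[B psiB]]; last first.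
  apply: (@le_lt_trans _ _ B%:E); last exact: ltry.
  by apply: ge_ereal_sup => _ [v _ <-]; rewrite lee_fin.
have ub v : ((normc (psi v))%:E <= sup_norm psi)%E.
  by apply: ereal_sup_ubound; exists v.
case/ge0_lty => [|B _ psiB].
  by apply: le_trans (ub a); rewrite lee_fin normc_ge0.
by exists B => v; rewrite -lee_fin -psiB.
Qed.

Lemma sigmaP psi : (sigma a psi < +oo)%E <->
  exists B, forall u w, adj u w -> (dist a u)%:R * normc (psi u - psi w) <= B.
Proof.
split=> [|[B psiB]]; last first.
  apply: (@le_lt_trans _ _ B%:E); last exact: ltry.
  by apply: ge_ereal_sup => _ [[u w] uw <-]; rewrite lee_fin; exact: psiB.
have ub u w : adj u w ->
    (((dist a u)%:R * normc (psi u - psi w))%:E <= sigma a psi)%E.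
  by move=> uw; apply: ereal_sup_ubound; exists (u, w).
case/ge0_lty => [|B _ psiB].
  have [w aw] := has_neighbour a.
  by apply: le_trans (ub _ _ aw); rewrite lee_fin mulr_ge0// normc_ge0.
by exists B => u w uw; rewrite -lee_fin -psiB; exact: ub.
Qed.

Lemma vanishing_varP f : vanishes_at_infinity a (max_var f) <->
  forall e, 0 < e -> exists N, forall u w, (N < dist a u)%N -> adj u w ->
    normc (f u - f w) < e.
Proof.
have mem u w : (w \in fset_set (nbh u)) = adj u w.
  rewrite in_fset_set; last exact: adj_finite.
  by rewrite adj_sym; apply/idP/idP => [/set_mem|/mem_set].
split=> fv e e0; have [N fN] := fv e e0; exists N.
  move=> u w Nu uw; apply: le_lt_trans (fN u Nu).
  apply: le_trans (ler_norm _); rewrite /max_var.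
  by apply: (le_bigmax_seq _ _ _ (fun w => normc (f u - f w))); rewrite ?mem.
move=> u Nu; rewrite ger0_norm /max_var; last exact: bigmax_ge_id.
rewrite big_seq; apply: bigmax_lt => // w; rewrite mem; exact: fN.
Qed.

End Suprema.

(** * Necessity: test functions *)

Section Necessity.
Variables (R : realType) (G : graph) (a : G) (psi : G -> R[i]).

(** The indicators and the radial bumps are both integer valued, which lets
one lemma place them in the little space and bound their norm. *)
Lemma nat_test_function (g : G -> nat) (N : nat) :
    (forall u w, adj u w -> (g u <= (g w).+1)%N) ->
    (forall u, (N < dist a u)%N -> g u = 0%N) ->
  Lip0 a (fun u => (g u)%:R : R[i]) /\
  (lip_norm a (fun u => (g u)%:R : R[i]) <= ((g a)%:R + 1)%:E)%E.
Proof.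
move=> g1 g0; set f := fun u => _.
have f1 u w : adj u w -> normc (f u - f w) <= 1.
  by move=> uw; apply: normc_natB_le1; apply: g1; rewrite // adj_sym.
split; last by rewrite /lip_norm EFinD normc_nat leeD// lip_semiP.
split; first by apply/(LipP a); exists 1.
apply/vanishing_varP => e e0; exists N.+1 => u w Nu uw.
have Nw : (N < dist a w)%N.
  by rewrite adj_sym in uw; have := dist_adj a uw; lia.
by rewrite /f !g0 ?subrr ?ComplexField.Normc.normc0//; lia.
Qed.

Variable X : set (G -> R[i]).
Hypotheses (Lip0X : Lip0 a `<=` X) (psiX : bounded_operator_on a X (mul_op psi)).

(** The little space is all that is tested, so one argument serves both
spaces. The uniform constant comes from [g a <= 1], which bounds the norm of
the test function by 2; the term [psi a * g a] of the norm is dropped. *)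
Lemma multiplier_test : exists B : R, forall (g : G -> nat) (N : nat),
    (forall u w, adj u w -> (g u <= (g w).+1)%N) ->
    (forall u, (N < dist a u)%N -> g u = 0%N) -> (g a <= 1)%N ->
  forall u w, adj u w ->
    normc (psi u * (g u)%:R - psi w * (g w)%:R) <= B.
Proof.
have [_ _ [M psiM]] := psiX; exists (`|M| * 2) => g N g1 g0 ga u w uw.
have [/Lip0X/psiM fM f2] := nat_test_function g1 g0.
move: u w uw; apply/(lip_semiP (mul_op psi (fun u => (g u)%:R))).
have n0 (f : G -> R[i]) : (0 <= lip_norm a f)%E.
  by rewrite adde_ge0 ?lip_semi_ge0// lee_fin normc_ge0.
apply: le_trans (le_trans fM _); first by rewrite leeDr// lee_fin normc_ge0.
apply: (@le_trans _ _ (`|M|%:E * lip_norm a (fun u => (g u)%:R : R[i]))%E).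
  by rewrite lee_wpmul2r// lee_fin ler_norm.
rewrite EFinM lee_wpmul2l// (le_trans f2)// lee_fin.
by rewrite (natrD R 1 1) lerD2r ler_nat.
Qed.

Lemma multiplier_sup_norm : exists B : R, forall v, normc (psi v) <= B.
Proof.
have [B psiB] := multiplier_test; exists B => v.
(* The indicator of [v] jumps across any edge from [v] to a neighbour. *)
have [w vw] := has_neighbour v.
have wv : (w == v) = false.
  by apply/eqP => wv; rewrite wv adj_irrefl in vw.
have := psiB (fun u => u == v) (dist a v) _ _ _ v w vw.
rewrite eqxx wv mulr1 mulr0 subr0; apply; last by case: (a == v).
- by move=> x y _; case: (x == v).
- by move=> u; case: eqP => // ->; rewrite ltnn.
Qed.

Lemma multiplier_sigma : exists B : R, forall u w, adj u w ->
  (dist a u)%:R * normc (psi u - psi w) <= B.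
Proof.
have [S psiS] := multiplier_sup_norm; have [B psiB] := multiplier_test.
exists (S + B) => v w vw; set n := dist a v.
(* A radial bump peaking on the sphere through [v]: it vanishes at [a], which
   keeps its norm independent of [n], and outside the ball of radius [2 n]. *)
pose g u := minn (dist a u) (n.*2 - dist a u).
have g1 x y : adj x y -> (g x <= (g y).+1)%N.
  move=> xy; have := dist_adj a xy; rewrite adj_sym in xy.
  by have := dist_adj a xy; rewrite /g; lia.
have gv : g v = n by rewrite /g -/n; lia.
have wv : adj w v by rewrite adj_sym.
have Bwv : normc (psi w * (g w)%:R - psi v * n%:R) <= B.
  rewrite -gv; apply: (psiB g n.*2) => //; last by rewrite /g dist_self min0n.
  by move=> u; rewrite /g; lia.
have dg : normc ((g w)%:R - n%:R : R[i]) <= 1.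
  by rewrite -gv; apply: normc_natB_le1; exact: g1.
have -> : n%:R * normc (psi v - psi w) =
    normc ((psi w * (g w)%:R - psi v * n%:R) - psi w * ((g w)%:R - n%:R)).
  rewrite -(normc_nat R n) normcBC -ComplexField.Normc.normcM.
  by congr normc; ring.
apply: le_trans (normcB_le _ _) _; rewrite addrC lerD//.
rewrite ComplexField.Normc.normcM -[S]mulr1.
by apply: ler_pM => //; exact: normc_ge0.
Qed.

End Necessity.

(** * Sufficiency: growth of Lipschitz functions *)

Section Sufficiency.
Variables (R : realType) (G : graph) (a : G).
Implicit Types (f psi : G -> R[i]).

(** Walk towards [a] along a geodesic: every step taken outside the ball of
radius [N] costs at most [e]. *)
Lemma growth f (N : nat) (K e : R) : 0 <= e ->
    (forall u, (dist a u <= N)%N -> normc (f u) <= K) ->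
    (forall u w, (N < dist a u)%N -> adj u w -> normc (f u - f w) <= e) ->
  forall v, normc (f v) <= K + e * (dist a v)%:R.
Proof.
move=> e0 fK fe v; move dv : (dist a v) => n.
elim: n => [|n IH] in v dv *; first by rewrite mulr0 addr0 fK// dv.
have [vN|Nv] := leqP (dist a v) N.
  by rewrite (le_trans (fK v vN))// lerDl mulr_ge0.
have [|u uv du] := @dist_pred G a v; first by rewrite dv.
rewrite adj_sym in uv.
have un : dist a u = n by apply/eqP; rewrite -eqSS -du dv.
have -> : f v = f u + (f v - f u) by rewrite addrC subrK.
apply: le_trans (normcD_le _ _) _.
by rewrite -natr1 mulrDr mulr1 addrA lerD ?IH ?fe.
Qed.

Lemma Lip_linear f (L : R) : 0 <= L ->
    (forall u w, adj u w -> normc (f u - f w) <= L) ->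
  forall v, normc (f v) <= normc (f a) + L * (dist a v)%:R.
Proof.
move=> L0 fL; apply: (growth (N := 0)) => // [u|u w _]; last exact: fL.
by rewrite leqn0 => /eqP/dist_eq0 ->.
Qed.

(** Outside a large ball each step costs at most [e]; the cost of the steps
inside the ball is absorbed into [K]. *)
Lemma Lip0_sublinear f (e : R) : Lip0 a f -> 0 < e ->
  exists2 K, 0 <= K & forall v, normc (f v) <= K + e * (dist a v)%:R.
Proof.
move=> [fLip /vanishing_varP f0] e0.
have [L L0 fE] := Lip_semi_real a fLip.
have /lip_semiP fL : (lip_semi f <= L%:E)%E by rewrite fE.
have [N fN] := f0 e e0; exists (normc (f a) + L * N%:R).
  by rewrite addr_ge0 ?normc_ge0// mulr_ge0.
apply: (growth (N := N)) => [|u uN|u w Nu uw]; first exact: ltW.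
  by rewrite (le_trans (Lip_linear L0 fL u))// lerD2l ler_wpM2l// ler_nat.
by rewrite ltW// fN.
Qed.

Variables (psi : G -> R[i]) (S s : R).
Hypothesis psiS : forall v, normc (psi v) <= S.
Hypothesis psis : forall u w, adj u w ->
  (dist a u)%:R * normc (psi u - psi w) <= s.

Let S0 : 0 <= S.
Proof. by apply: le_trans (psiS a); exact: normc_ge0. Qed.

Let s0 : 0 <= s.
Proof. by have [w /psis] := has_neighbour a; rewrite dist_self mul0r. Qed.

(** [sigma] ranges over ordered pairs, so the weight may sit on the end of the
edge where the Leibniz rule evaluates [f]. *)
Let psis_sym u w : adj u w -> (dist a w)%:R * normc (psi u - psi w) <= s.
Proof. by rewrite adj_sym normcBC; exact: psis. Qed.

(** With [e] the seminorm of [f] this bounds the seminorm of [psi f]; with [e]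
small it shows that the variation of [psi f] vanishes at infinity. *)
Lemma multiplier_var f (K e : R) : 0 <= e ->
    (forall v, normc (f v) <= K + e * (dist a v)%:R) ->
  forall u w, adj u w ->
    normc (psi u * f u - psi w * f w) <=
    S * normc (f u - f w) + (K * normc (psi u - psi w) + e * s).
Proof.
move=> e0 fK u w uw; apply: le_trans (normc_leibniz _ _ _ _) _.
apply: lerD; first by apply: ler_wpM2r (psiS u); exact: normc_ge0.
apply: le_trans (ler_wpM2r (normc_ge0 _) (fK w)) _.
by rewrite mulrDl lerD2l -mulrA ler_wpM2l// psis_sym.
Qed.

Lemma multiplier_lip_norm f : Lip f ->
  (lip_norm a (mul_op psi f) <= (3 * S + s)%:E * lip_norm a f)%E.
Proof.
move=> /(Lip_semi_real a)[L L0 fE].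
have /lip_semiP fL : (lip_semi f <= L%:E)%E by rewrite fE.
have fa := normc_ge0 (f a).
have semi : (lip_semi (mul_op psi f) <=
    (S * L + (normc (f a) * (2 * S) + L * s))%:E)%E.
  apply/lip_semiP => u w uw.
  apply: le_trans (multiplier_var L0 (Lip_linear L0 fL) uw) _.
  rewrite lerD ?ler_wpM2l ?fL// lerD2r ler_wpM2l//.
  by rewrite (le_trans (normcB_le _ _))// mulr_natl mulr2n lerD.
rewrite /lip_norm fE -EFinD -EFinM; apply: le_trans (leeD2l _ semi) _.
rewrite -EFinD lee_fin /mul_op /= ComplexField.Normc.normcM.
have := ler_wpM2r fa (psiS a); have := mulr_ge0 S0 L0; have := mulr_ge0 s0 fa.
nra.
Qed.

Lemma multiplier_Lip f : Lip f -> Lip (mul_op psi f).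
Proof.
move=> fLip; have [L _ fE] := Lip_semi_real a fLip.
have : (lip_norm a (mul_op psi f) < +oo)%E.
  apply: le_lt_trans (multiplier_lip_norm fLip) _.
  by rewrite /lip_norm fE -EFinD -EFinM ltry.
apply: le_lt_trans; rewrite /lip_norm leeDr// lee_fin; exact: normc_ge0.
Qed.

Lemma multiplier_Lip0 f : Lip0 a f -> Lip0 a (mul_op psi f).
Proof.
move=> f0; have [fLip /vanishing_varP fv] := f0.
split; first exact: multiplier_Lip.
apply/vanishing_varP => e e0.
have e3 : 0 < e / 3 by rewrite divr_gt0.
(* Each of the three terms of [multiplier_var] is made at most [e / 3]: the
   first by vanishing variation, the second by the decay [s / dist a u] of
   the variation of [psi], the third by sublinear growth. The divisors are
   increased by 1 because [S] and [s] may be 0. *)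
have S1 : 0 < S + 1 by rewrite ltr_wpDl.
have s1 : 0 < s + 1 by rewrite ltr_wpDl.
have [N1 fN1] := fv _ (divr_gt0 e3 S1).
have [K K0 fK] := Lip0_sublinear f0 (divr_gt0 e3 s1).
pose N2 := Num.truncn (K * s / (e / 3)).
exists (maxn N1 N2) => u w; rewrite gtn_max => /andP[N1u N2u] uw.
apply: le_lt_trans (multiplier_var (ltW (divr_gt0 e3 s1)) fK uw) _.
have t1 : S * normc (f u - f w) < e / 3.
  apply: (@le_lt_trans _ _ ((S + 1) * normc (f u - f w))).
    by rewrite ler_wpM2r ?normc_ge0// lerDl.
  by rewrite mulrC -ltr_pdivlMr// fN1.
have t3 : e / 3 / (s + 1) * s <= e / 3.
  by rewrite mulrAC ler_pdivrMr// ler_wpM2l ?lerDl// ltW.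
have t2 : K * normc (psi u - psi w) < e / 3.
  have du0 : 0 < (dist a u)%:R :> R by rewrite ltr0n (leq_ltn_trans _ N2u).
  rewrite -(ltr_pM2l du0) mulrCA.
  apply: le_lt_trans (ler_wpM2l K0 (psis uw)) _.
  rewrite -ltr_pdivrMr//; apply: lt_le_trans (truncnS_gt _) _.
  by rewrite ler_nat.
lra.
Qed.

Lemma multiplier_bounded (X : set (G -> R[i])) : X `<=` @Lip R G ->
    (forall f, X f -> X (mul_op psi f)) ->
  bounded_operator_on a X (mul_op psi).
Proof.
move=> XLip Xpsi; split=> // [c f g _ _|].
  by apply/funext => v; rewrite /mul_op /= mulrDr mulrCA.
by exists (3 * S + s) => f /XLip; exact: multiplier_lip_norm.
Qed.

End Sufficiency.

(** * Characterization of the bounded multipliers *)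

Theorem theorem5p3 (R : realType) (G : graph) (a : G) (psi : G -> R[i]) :
  [<-> bounded_operator_on a (@Lip R G) (mul_op psi);
       bounded_operator_on a (@Lip0 R G a) (mul_op psi);
       (sup_norm psi < +oo)%E /\ (sigma a psi < +oo)%E ].
Proof.
have necessity X : Lip0 a `<=` X -> bounded_operator_on a X (mul_op psi) ->
    (sup_norm psi < +oo)%E /\ (sigma a psi < +oo)%E.
  move=> Lip0X psiX; split.
    apply/(sup_normP a); exact: multiplier_sup_norm Lip0X psiX.
  apply/sigmaP; exact: multiplier_sigma Lip0X psiX.
have Lip0_Lip : @Lip0 R G a `<=` @Lip R G by move=> f [].
tfae.
- move=> /(necessity _ Lip0_Lip)[/(sup_normP a)[S psiS] /sigmaP[s psis]].
  apply: (multiplier_bounded psiS psis Lip0_Lip).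
  exact: (multiplier_Lip0 psiS psis).
- by apply: necessity.
- move=> [/(sup_normP a)[S psiS] /sigmaP[s psis]].
  apply: (multiplier_bounded psiS psis) => //.
  exact: (multiplier_Lip psiS psis).
Qed.
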